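(* Let $d,\gamma\in\mathbb{N}$ be arbitrarily fixed with $\gamma\ge2$. For every $n\ge d$ let nodes $a=x_0<x_1<\dots<x_n=b$ (depending on $n$) be given such that $h\sim h^*\sim n^{-1}$ as $n\to\infty$. Then for any continuous function $f\in C([a,b])$ the generalized Floater--Hormann interpolants satisfy $$\lim_{n\to\infty}\|\tilde r(f)-f\|_\infty=0.$$
   Context: $\mathbb{N}=\{1,2,3,\ldots\}$; $\|g\|_\infty=\sup_{x\in[a,b]}|g(x)|$. For nodes $a=x_0<\dots<x_n=b$, $h=\max_{0\le k<n}(x_{k+1}-x_k)$ and $h^*=\min_{0\le k<n}(x_{k+1}-x_k)$; $u\sim v$ means that the ratio $u/v$ lies between two positive constants independent of $n$. For $i=0,\ldots,n-d$ let $p_i$ be the unique polynomial of degree $\le d$ interpolating $f$ at $x_i,\ldots,x_{i+d}$, and let $\tilde\lambda_i(x)=(-1)^{i\gamma}\prod_{s=i}^{i+d}(x-x_s)^{-\gamma}$. The generalized Floater--Hormann interpolant of $f$ is $$\tilde r(f,x)=\frac{\sum_{i=0}^{n-d}\tilde\lambda_i(x)p_i(x)}{\sum_{i=0}^{n-d}\tilde\lambda_i(x)},$$ a rational function without real poles, with $\tilde r(f,x_k)=f(x_k)$ at the nodes. *)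

(* Defs.v *)
From HB Require Import structures.
From mathcomp Require Import all_boot all_order all_algebra.
From mathcomp Require Import all_classical all_reals all_analysis.
Set Implicit Arguments.
Unset Strict Implicit.
Unset Printing Implicit Defensive.
Import Order.TTheory GRing.Theory Num.Theory.
Import numFieldNormedType.Exports.
Local Open Scope classical_set_scope.
Local Open Scope ring_scope.

(* The nodes x_0, ..., x_n are the first n.+1 terms of a sequence x : nat -> R;
   its later terms are irrelevant. *)
Definition is_nodes (R : realType) (a b : R) (n : nat) (x : nat -> R) : Prop :=
  [/\ x 0%N = a, x n = b & forall k : nat, (k < n)%N -> x k < x k.+1].

(* The gaps of a nonempty grid are positive and at most x_n - x_0, so the
   neutral elements 0 and x_n - x_0 do not affect the maximum and the minimum. *)
Definition max_gap (R : realType) (n : nat) (x : nat -> R) : R :=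
  \big[Num.max/0]_(k < n) (x k.+1 - x k).

Definition min_gap (R : realType) (n : nat) (x : nat -> R) : R :=
  \big[Num.min/(x n - x 0%N)]_(k < n) (x k.+1 - x k).

Definition same_order (R : realType) (u v : nat -> R) : Prop :=
  exists c C : R, [/\ 0 < c, 0 < C & \forall n \near \oo, c <= u n / v n <= C].

Definition interpolates (R : realType) (f : R -> R) (x : nat -> R) (d i : nat)
    (p : {poly R}) : Prop :=
  (size p <= d.+1)%N /\
  forall s : nat, (i <= s <= i + d)%N -> p.[x s] = f (x s).

(* The default value 0 is never used for distinct nodes, see interp_polyP. *)
Definition interp_poly (R : realType) (f : R -> R) (x : nat -> R) (d i : nat) :
    {poly R} :=
  xget 0 [set p | interpolates f x d i p].

Definition fh_weight (R : realType) (d gamma : nat) (x : nat -> R) (i : nat)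
    (t : R) : R :=
  (-1) ^+ (i * gamma) * \prod_(i <= s < (i + d).+1) (t - x s) ^- gamma.

(* Off the nodes this is the defining quotient. The weights have poles at the
   nodes, where the quotient has removable singularities: the rational function
   it defines takes the value f (x k) at x k. *)
Definition fh_interpolant (R : realType) (d gamma n : nat) (x : nat -> R)
    (f : R -> R) (t : R) : R :=
  if [exists k : 'I_n.+1, t == x k] then f t else
    (\sum_(0 <= i < (n - d).+1)
       fh_weight d gamma x i t * (interp_poly f x d i).[t]) /
    (\sum_(0 <= i < (n - d).+1) fh_weight d gamma x i t).

(* Extended-real valued, since sup is 0 on unbounded sets of reals. *)
Definition sup_norm (R : realType) (a b : R) (g : R -> R) : \bar R :=
  ereal_sup [set `|g t|%:E | t in `[a, b]].

Section InterpolationPolynomial.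
Variables (R : realType) (f : R -> R) (x : nat -> R).

Lemma interpolates_exists (d i : nat) :
  {in [pred s | i <= s <= i + d]%N &, injective x} ->
  exists p : {poly R}, interpolates f x d i p.
Proof.
elim: d => [|d IHd] xI.
  exists (f (x i))%:P; split; first exact: size_polyC_leq1.
  by move=> s; rewrite addn0 -eqn_leq => /eqP <-; rewrite hornerC.
have {IHd}/IHd[p [sp pP]] : {in [pred s | i <= s <= i + d]%N &, injective x}.
  move=> s t; rewrite !inE => /andP[is_ sd] /andP[it td].
  by apply: xI; rewrite inE ?is_ ?it /= addnS leqW.
pose q : {poly R} := \prod_(y <- [seq x s | s <- iota i d.+1]) ('X - y%:P).
have sq : size q = d.+2.
  by rewrite size_prod_XsubC size_map size_iota.
have q0 : q.[x (i + d.+1)%N] != 0.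
  rewrite -/(root q _) root_prod_XsubC; apply/mapP => -[s].
  rewrite mem_iota => /andP[is_ sd] xE.
  have /eqP : (i + d.+1)%N = s.
    by apply: xI; rewrite ?inE ?leq_addr ?leqnn ?is_ //= ltnW.
  by rewrite gtn_eqF.
pose c := (f (x (i + d.+1)%N) - p.[x (i + d.+1)%N]) / q.[x (i + d.+1)%N].
exists (p + c *: q); split.
  rewrite (leq_trans (size_polyD _ _))// geq_max (leqW sp)/=.
  by rewrite (leq_trans (size_scale_leq _ _))// sq.
move=> s /andP[is_]; rewrite leq_eqVlt => /orP[/eqP ->|sd].
  by rewrite hornerD hornerZ /c divfK// addrC subrK.
have /rootP qs : root q (x s).
  by rewrite root_prod_XsubC map_f// mem_iota is_.
rewrite hornerD hornerZ qs mulr0 addr0; apply: pP.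
by rewrite is_ /= -ltnS -addnS.
Qed.

Lemma interpolates_unique (d i : nat) (p q : {poly R}) :
  {in [pred s | i <= s <= i + d]%N &, injective x} ->
  interpolates f x d i p -> interpolates f x d i q -> p = q.
Proof.
move=> xI [sp pP] [sq qP]; apply/eqP; rewrite -subr_eq0; apply/negPn/negP => r0.
have iE s : s \in iota i d.+1 = (i <= s <= i + d)%N.
  by rewrite mem_iota addnS ltnS.
have U : uniq [seq x s | s <- iota i d.+1].
  rewrite map_inj_in_uniq ?iota_uniq// => s t; rewrite !iE => si ti.
  by apply: xI.
have A : all (root (p - q)) [seq x s | s <- iota i d.+1].
  apply/allP => y /mapP[s]; rewrite iE => si ->.
  by apply/rootP; rewrite hornerD hornerN pP// qP// subrr.
have := max_poly_roots r0 A U.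
rewrite size_map size_iota ltnNge (leq_trans (size_polyD _ _))//.
by rewrite size_polyN geq_max sp.
Qed.

Lemma interp_polyP (d i : nat) :
  {in [pred s | i <= s <= i + d]%N &, injective x} ->
  interpolates f x d i (interp_poly f x d i).
Proof.
by move=> /interpolates_exists; exact: xgetPex.
Qed.

End InterpolationPolynomial.

(* Main.v *)
(* Let t lie in the cell (x_k, x_{k+1}) and put m_i = |i - k| + 1. The weights of
   the windows {x_i, ..., x_{i+d}} containing the cell share one sign, and on both
   sides of these the weights either all have that sign or alternate, starting with
   it and decaying; hence the denominator dominates any single weight lambda_j with
   a window containing the cell. Quasi-uniformity gives
   |lambda_i / lambda_j| <= const m_i^(-gamma (d+1)), and, as
   |f(x_s) - f(t)| <= eps + K |x_s - t|, the Lagrange formula gives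
   |p_i(t) - f(t)| <= const m_i^(d+1) (eps + K (d+1) h). For gamma >= 2 the product
   is at most const m_i^(-2) (eps + K (d+1) h), which is summable uniformly in n. *)

Require Import Defs.
From mathcomp Require Import all_boot all_order all_algebra.
From mathcomp Require Import all_classical all_reals all_analysis.
From mathcomp Require Import zify ring lra.
Import Order.TTheory GRing.Theory Num.Theory.
Import numFieldNormedType.Exports.
Local Open Scope classical_set_scope.
Local Open Scope ring_scope.

(** * Modulus of continuity and elementary sums *)

(** A modulus affine in the distance, in place of the usual delta, also controls [f] at nodes far
    from the evaluation point, with only linear growth. Close points are handled by continuity,
    distant ones by boundedness once [K] is large. *)
Lemma within_continuous_modulus (R : realType) (a b : R) (f : R -> R) :
  {within `[a, b], continuous f} ->
  forall e : R, 0 < e -> exists2 K : R, 0 <= K &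
    {in `[a, b] &, forall s t, `|f s - f t| <= e + K * `|s - t|}.
Proof.
move=> cf e e0; have cab := @segment_compact R a b.
have [M M0 fM] : exists2 M : R, 0 <= M & {in `[a, b], forall t, `|f t| <= M}.
  have /compact_bounded [M [_ MP]] := continuous_compact cf cab.
  exists (Num.max 0 (M + 1)); first by rewrite le_max lexx.
  move=> t tab; rewrite le_max; apply/orP; right.
  by apply: (MP (M + 1)); [rewrite ltrDl|exists t].
(* Compactness as a covering property: a bound valid for all large [K] near each point of the
   segment is valid for all large [K] on the whole segment at once. *)
have /compact_near_coveringP/near_covering_withinP cov := cab.
have F := cov R (pinfty_nbhs R) (fun K s => forall t, t \in `[a, b] ->
  `|f s - f t| <= e + K * `|s - t|) _.
suff [K [_ KP]] : \forall K \near +oo, `[a, b] `<=` (fun s => forall t,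
    t \in `[a, b] -> `|f s - f t| <= e + K * `|s - t|).
  exists (Num.max 0 (K + 1)); first by rewrite le_max lexx.
  move=> s t sab tab; apply: KP => //.
  by rewrite lt_max ltrDl ltr01 orbT.
apply: F => c cab'.
have e20 : 0 < e / 2 by rewrite divr_gt0.
have [r /= r0 rP] : exists2 r : R, 0 < r & forall t, `|c - t| < r ->
    t \in `[a, b] -> `|f c - f t| < e / 2.
  have /subspace_continuousP/(_ c cab')/cvgrPdist_lt/(_ _ e20) := cf.
  by case=> r /= r0 rP; exists r.
(* If [t] is within [r] of [c], both values are within [e / 2] of [f c]. Otherwise [s] and [t] are
   at least [r / 2] apart, and [K > 4 * M / r] makes [K * (r / 2)] exceed the trivial bound
   [2 * M]. *)
exists (ball c (r / 2), [set K | 4 * M / r < K]) => /=.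
  split; first by exists (r / 2); rewrite /= ?divr_gt0.
  by exists (4 * M / r); split => //; rewrite num_real.
move=> [s K] [/= cs rK] sab t tab.
have r20 : 0 < r / 2 by rewrite divr_gt0.
have K0 : 0 <= K 
  by apply: le_trans (ltW rK); apply: divr_ge0; [exact: mulr_ge0|exact: ltW].
have cs' : `|c - s| < r / 2 by [].
have [tr|rt] := ltP `|c - t| r.
  have h1 : `|f c - f t| < e / 2 by apply: rP.
  have h2 : `|f c - f s| < e / 2.
    by apply: rP => //=; apply: lt_trans cs' _; lra.
  have -> : f s - f t = (f c - f t) - (f c - f s) by lra.
  apply: (@le_trans _ _ e); last by rewrite lerDl mulr_ge0.
  by rewrite (le_trans (ler_normB _ _))//; lra.
have st : r / 2 <= `|s - t|.
  have : `|c - t| <= `|c - s| + `|s - t|.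
    by have := ler_normD (c - s) (s - t); rewrite addrA subrK.
  by lra.
apply: (@le_trans _ _ (2 * M)).
  by have := ler_normB (f s) (f t); have := fM s sab; have := fM t tab; lra.
have : 2 * M <= K * (r / 2).
  by move: rK; rewrite ltr_pdivrMr// => rK; lra.
have : K * (r / 2) <= K * `|s - t| by rewrite ler_wpM2l.
by lra.
Qed.

(** Taking [z] to be [(-1) ^+ gamma] treats both parities of [gamma] at once: the terms are all
    nonnegative, or they alternate and decrease. *)
Lemma alternating_sum_ge0 (R : realDomainType) (z : R) (u : nat -> R) N :
  z ^+ 2 = 1 -> (forall i, (i < N)%N -> 0 <= u i) ->
  (forall i, (i.+1 < N)%N -> u i.+1 <= u i) ->
  0 <= \sum_(0 <= i < N) z ^+ i * u i.
Proof.
move=> z2 u0 uS.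
have /orP[/eqP ->|/eqP {z z2}->] : (z == 1) || (z == -1) by rewrite -sqrf_eq1 z2.
  by rewrite big_seq sumr_ge0// => i; rewrite mem_index_iota expr1n mul1r => /u0.
(* The induction needs the upper bound by the first term as well, because peeling off that term
   negates the remaining sum. *)
suff : 0 <= \sum_(0 <= i < N) (-1) ^+ i * u i <= (if N is 0 then 0 else u 0%N).
  by case/andP.
elim: N u u0 uS => [|N IH] u u0 uS; first by rewrite big_nil lexx.
rewrite big_nat_recl// expr0 mul1r.
under eq_bigr do rewrite exprS mulN1r mulNr.
rewrite sumrN /=.
have := IH (fun i => u i.+1) (fun i iN => u0 i.+1 iN) (fun i iN => uS i.+1 iN).
have := u0 0%N isT.
case: N {IH} uS u0 => [|N] uS u0 u00 /andP[h1 h2]; first by lra.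
by have := uS 0%N isT; lra.
Qed.

(** Each term is at most an increment of [F], by [1/m^2 <= 2/m - 2/(m+1)] applied on either side of
    [k]; the increments telescope and [F] stays between 0 and 4. *)
Lemma sum_inv_sqr_dist (R : realFieldType) (k N : nat) :
  \sum_(0 <= i < N) ((`|i - k|%N).+1%:R ^+ 2)^-1 <= 4 :> R.
Proof.
pose F (i : nat) : R := if (i <= k)%N then 2 / (k - i).+1%:R else 4 - 2 / (i - k).+1%:R.
have inv_sqr (m : nat) :
    (m.+1%:R ^+ 2)^-1 <= 2 / m.+1%:R - 2 / m.+2%:R :> R.
  have m0 : 0 < m.+1%:R :> R by [].
  have -> : 2 / m.+1%:R - 2 / m.+2%:R = 2 / (m.+1%:R * m.+2%:R) :> R.
    rewrite -(natr1 m.+1); move: (m.+1%:R : R) m0 => y y0; field.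
    by apply/andP; split; apply: lt0r_neq0; lra.
  rewrite ler_pdivlMr ?mulr_gt0// mulrC ler_pdivrMr ?exprn_gt0//.
  rewrite -(natr1 m.+1); have : 1 <= m.+1%:R :> R by rewrite ler1n.
  by nra.
have FS (i : nat) : ((`|i - k|%N).+1%:R ^+ 2)^-1 <= F i.+1 - F i.
  rewrite /F; case: (ltngtP i k) => ik.
  - have [m ->] : exists m, k = (i + m.+1)%N by exists (k - i.+1)%N; lia.
    have -> : `|i - (i + m.+1)%N|%N = m.+1 by lia.
    have -> : (i + m.+1 - i.+1)%N = m by lia.
    have -> : (i + m.+1 - i)%N = m.+1 by lia.
    apply: le_trans (inv_sqr m); rewrite lef_pV2 ?posrE ?exprn_gt0//.
    by rewrite lerXn2r ?nnegrE// ler_nat.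
  - have [m ->] : exists m, i = (k + m.+1)%N by exists (i - k.+1)%N; lia.
    have -> : `|(k + m.+1)%N - k|%N = m.+1 by lia.
    have -> : ((k + m.+1).+1 - k)%N = m.+2 by lia.
    have -> : (k + m.+1 - k)%N = m.+1 by lia.
    apply: le_trans (inv_sqr m.+1) _.
    by move: (2 / m.+2%:R) (2 / m.+3%:R) => u v; lra.
  - by rewrite ik subnn distnn subSnn expr1n invr1; lra.
apply: (@le_trans _ _ (\sum_(0 <= i < N) (F i.+1 - F i))).
  by apply: ler_sum => i _; exact: FS.
rewrite telescope_sumr//.
have F0 : 0 <= F 0%N by rewrite /F leq0n divr_ge0.
suff : F N <= 4 by lra.
rewrite /F; case: leqP => _; last by rewrite gerBl divr_ge0.
rewrite ler_pdivrMr//; have : 1 <= (k - N).+1%:R :> R by rewrite ler1n.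
by lra.
Qed.

(** * Interpolation and node products on a grid *)

Lemma increments_sum (R : realFieldType) (x : nat -> R) (n : nat) (q H : R) :
  (forall k, (k < n)%N -> q <= x k.+1 - x k <= H) ->
  forall s r, (s <= r <= n)%N ->
    q * (r - s)%:R <= x r - x s <= H * (r - s)%:R.
Proof.
move=> gap s r /andP[sr rn]; elim: r sr rn => [|r IH].
  by rewrite leqn0 => /eqP ->; rewrite subnn !mulr0 subrr lexx.
rewrite leq_eqVlt => /orP[/eqP ->|]; first by rewrite subnn !mulr0 subrr lexx.
rewrite ltnS => sr rn; have /andP[q1 H1] := gap r rn.
have /andP[q2 H2] := IH sr (ltnW rn).
by rewrite subSn// -natr1 !mulrDr !mulr1; apply/andP; split; lra.
Qed.

(** Expand [p - v] in the Lagrange basis: a basis polynomial at [t] is a product of [d] quotients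
    with numerator at most [T] and denominator at least [q], and there are [d.+1] of them. *)
Lemma polynomial_deviation (R : realFieldType) (d : nat) (y : nat -> R)
    (p : {poly R}) (t v q T V : R) :
  (size p <= d.+1)%N -> 0 < q ->
  (forall s, (s < d)%N -> q <= y s.+1 - y s) ->
  (forall s, (s <= d)%N -> `|t - y s| <= T) ->
  (forall s, (s <= d)%N -> `|p.[y s] - v| <= V) ->
  `|p.[t] - v| <= d.+1%:R * (T / q) ^+ d * V.
Proof.
move=> sp q0 gap tT pV.
(* [lagrange_gen] wants globally injective nodes: continue them with step q *)
pose z s := y (minn s d) + q * (s - d)%:R.
have zE s : (s <= d)%N -> z s = y s.
  by move=> sd; rewrite /z (minn_idPl sd) (eqP sd) mulr0 addr0.
have zgap s : q <= z s.+1 - z s.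
  rewrite /z; have [sd|ds] := ltnP s d.
    have -> : minn s.+1 d = s.+1 by lia.
    have -> : (s.+1 - d = 0)%N by lia.
    have -> : (s - d = 0)%N by lia.
    by rewrite mulr0 !addr0 gap.
  have -> : minn s.+1 d = d by lia.
  by rewrite subSn// -natr1; lra.
have zsep s r : (s < r)%N -> q <= `|z s - z r|.
  move=> sr; rewrite distrC; apply: le_trans (ler_norm _).
  have : q * (r - s)%:R <= z r - z s.
    elim: r sr => // r IH; rewrite ltnS leq_eqVlt => /orP[/eqP ->|].
      by rewrite subSnn mulr1.
    move=> sr; have := IH sr; have := zgap r.
    by rewrite subSn 1?ltnW// -natr1; lra.
  have : 1 <= (r - s)%:R :> R by rewrite ler1n subn_gt0.
  by nra.
have zsep2 s r : s != r -> q <= `|z s - z r|.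
  by rewrite neq_ltn => /orP[/zsep//|/zsep]; rewrite distrC.
have zinj : injective z.
  move=> s r zsr; apply/eqP/negPn/negP => /zsep2.
  by rewrite zsr subrr normr0 leNgt q0.
have T0 : 0 <= T by apply: le_trans (tT 0%N isT).
have -> : p.[t] - v = (p - v%:P).[t] by rewrite !hornerE.
have spv : (size (p - v%:P)%R <= d.+1)%N.
  by rewrite (leq_trans (size_polyD _ _))// geq_max sp size_polyN size_polyC; case: eqP.
rewrite (lagrange_gen (ltn0Sn d) zinj spv) horner_sum.
apply: (le_trans (ler_norm_sum _ _ _)).
apply: (@le_trans _ _ (\sum_(i < d.+1) (T / q) ^+ d * V)); last first.
  by rewrite sumr_const card_ord -[leLHS]mulr_natl mulrA.
apply: ler_sum => i _; rewrite lagrangeE//= hornerM hornerC normrM mulrC.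
have iz (j : 'I_d.+1) : z j = y j by rewrite zE// -ltnS.
rewrite ler_pM//; last by rewrite iz hornerD hornerN hornerC pV// -ltnS.
rewrite hornerM hornerC !horner_prod normrM normfV !normr_prod mulrC -prodf_div.
apply: (@le_trans _ _ (\prod_(j < d.+1 | j != i) (T / q))); last first.
  by rewrite prodr_const cardC1 card_ord.
apply: ler_prod => j ji; rewrite divr_ge0//= !hornerXsubC.
rewrite ler_pM ?invr_ge0//; first by rewrite iz tT// -ltnS.
have qz : q <= `|z i - z j| by apply: zsep2; rewrite eq_sym.
by rewrite lef_pV2 ?posrE//; apply: lt_le_trans qz.
Qed.

(* Only the two factors nearest to [t] can be arbitrarily small. A window that
   contains both of them is compared with any other window through the product
   over all indices of the ratios [e s / E s <= 1], which differ from 1 only at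
   those two. *)
Lemma window_prod_compare (R : realFieldType) (n d k i j : nat) (e E : nat -> R) :
  (forall s, (s <= n)%N -> 0 < e s <= E s) ->
  (forall s, (s <= n)%N -> s != k -> s != k.+1 -> E s = e s) ->
  (i + d <= n)%N -> (j <= k < j + d)%N -> (j + d <= n)%N ->
  (\prod_(j <= s < (j + d).+1) e s) * (\prod_(i <= s < (i + d).+1) E s) <=
  (\prod_(i <= s < (i + d).+1) e s) * (\prod_(j <= s < (j + d).+1) E s).
Proof.
move=> eE Ee idn /andP[jk kj] jdn.
have E0 s : (s <= n)%N -> 0 < E s by move=> /eE/andP[]; exact: lt_le_trans.
have prod_gt0 (F : nat -> R) l r : (r <= n.+1)%N ->
    (forall s, (s <= n)%N -> 0 < F s) -> 0 < \prod_(l <= s < r) F s.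
  move=> rn F0; rewrite big_seq prodr_gt0// => s; rewrite mem_index_iota.
  by move=> /andP[_ sr]; apply: F0; rewrite -ltnS (leq_trans sr).
pose rho s := e s / E s.
have rho01 s : (s <= n)%N -> 0 <= rho s <= 1.
  move=> sn; have /andP[h1 h2] := eE s sn.
  by rewrite ler_pdivrMr ?E0// mul1r h2 divr_ge0// ltW// E0.
have rho_le1 l r : (r <= n.+1)%N -> 0 <= \prod_(l <= s < r) rho s <= 1.
  move=> rn; have sn s : s \in index_iota l r -> 0 <= rho s <= 1.
    by rewrite mem_index_iota => /andP[_ sr]; apply: rho01 (leq_trans sr rn).
  rewrite big_seq; apply/andP; split; last exact: prodr_ile1.
  by apply: prodr_ge0 => s /sn/andP[].
have rho1 l r : (r <= n.+1)%N -> (k.+1 < l)%N || (r <= k)%N ->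
    \prod_(l <= s < r) rho s = 1.
  move=> rn klr; rewrite big_seq big1// => s; rewrite mem_index_iota.
  move=> /andP[ls sr]; have sn : (s <= n)%N by rewrite -ltnS (leq_trans sr).
  rewrite /rho Ee//; first by rewrite divff// gt_eqF//; have /andP[] := eE s sn.
    by apply/eqP; lia.
  by apply/eqP; lia.
have full l : (l + d <= n)%N -> \prod_(0 <= s < n.+1) rho s =
    \prod_(0 <= s < l) rho s * \prod_(l <= s < (l + d).+1) rho s *
    \prod_((l + d).+1 <= s < n.+1) rho s.
  by move=> ldn; rewrite -!big_cat_nat//=; lia.
have : \prod_(j <= s < (j + d).+1) rho s <= \prod_(i <= s < (i + d).+1) rho s.
  have := full i idn; rewrite (full j jdn).
  rewrite (rho1 0%N j) ?mul1r; [|lia|by rewrite jk orbT].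
  rewrite (rho1 (j + d).+1 n.+1) ?mulr1; [|lia|by rewrite ltnS kj].
  move=> ->.
  have /andP[h1 h2] := rho_le1 0%N i ltac:(lia).
  have /andP[h3 h4] := rho_le1 (i + d).+1 n.+1 ltac:(lia).
  have /andP[h5 _] := rho_le1 i (i + d).+1 ltac:(lia).
  by rewrite -[leRHS]mulr1 ler_pM ?mulr_ge0// -[leRHS]mul1r ler_wpM2r.
rewrite !prodf_div ler_pdivrMr; last by apply: prod_gt0 => //; lia.
rewrite mulrAC ler_pdivlMr//; apply: prod_gt0 => //; lia.
Qed.

(** With truncated subtraction, [(i + d - k) + (i - k.+1)] has the parity of the number of window
    indices above [k]: for [i > k] it exceeds [d.+1] by twice [i - k.+1]. *)
Lemma prod_signed (R : realDomainType) (e : nat -> R) (k i d : nat) :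
  \prod_(i <= s < (i + d).+1) ((-1) ^+ (k < s)%N * e s) =
  (-1) ^+ ((i + d - k) + (i - k.+1)) * \prod_(i <= s < (i + d).+1) e s.
Proof.
rewrite big_split /=; congr (_ * _).
elim: d => [|d IH].
  rewrite addn0 big_nat1 -[LHS]signr_odd -[RHS]signr_odd; congr (_ ^+ _).
  by case: ltnP => ki; lia.
rewrite addnS big_nat_recr/=; last by lia.
rewrite IH -exprD -[LHS]signr_odd -[RHS]signr_odd; congr (_ ^+ _).
by case: ltnP => ki; lia.
Qed.

(** * The error at a point inside one cell of the grid *)

Section Cell.
Variables (R : realType) (n d gamma k : nat) (x : nat -> R) (t q H : R).
Hypotheses (q_gt0 : 0 < q)
  (gap : forall s, (s < n)%N -> q <= x s.+1 - x s <= H)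
  (kn : (k < n)%N) (xkt : x k < t < x k.+1) (d_gt0 : (0 < d)%N) (dn : (d <= n)%N).

Let m (s : nat) : nat := (`|s - k|%N).+1.
Let P (i : nat) : R := \prod_(i <= s < (i + d).+1) `|t - x s|.
(** The leftmost window containing both ends of the cell; truncation makes it 0 near the left end of
    the grid. *)
Let j : nat := (k.+1 - d)%N.

Let qH : q <= H. Proof. by have /andP[/le_trans] := gap k kn; apply. Qed.
Let H_gt0 : 0 < H. Proof. exact: lt_le_trans qH. Qed.

Let left_node s : (s <= k)%N ->
  [/\ q * (k - s)%:R < t - x s, t - x s <= H * (m s)%:R & `|t - x s| = t - x s].
Proof.
move=> sk; have := @increments_sum _ x n q H gap s k; rewrite sk ltnW//.
move=> /(_ isT)/andP[h1 h2]; have /andP[g1 g2] := gap k kn; have /andP[t1 t2] := xkt.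
have -> : m s = (k - s).+1 by rewrite /m; lia.
have q0 : 0 <= q * (k - s)%:R by rewrite mulr_ge0// ltW.
by rewrite -natr1 mulrDr mulr1; split; [lra|lra|rewrite gtr0_norm//; lra].
Qed.

Let right_node s : (k < s <= n)%N ->
  [/\ q * (s - k.+1)%:R < x s - t, x s - t <= H * (m s)%:R & `|t - x s| = x s - t].
Proof.
move=> ksn; have /andP[ks _] := ksn; have := @increments_sum _ x n q H gap k.+1 s ksn.
move=> /andP[h1 h2]; have /andP[g1 g2] := gap k kn; have /andP[t1 t2] := xkt.
have -> : m s = (s - k.+1).+2 by rewrite /m; lia.
have q0 : 0 <= q * (s - k.+1)%:R by rewrite mulr_ge0// ltW.
rewrite -natr1 -natr1 !mulrDr !mulr1; split; [lra|lra|].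
by rewrite distrC gtr0_norm//; lra.
Qed.

Let dist_le s : (s <= n)%N -> `|t - x s| <= H * (m s)%:R.
Proof.
move=> sn; have [sk|ks] := leqP s k; first by have [_ ? ->] := left_node _ sk.
by have [|_ ? ->] := @right_node s; rewrite ?ks.
Qed.

Let dist_gt0 s : (s <= n)%N -> 0 < `|t - x s|.
Proof.
move=> sn; have [sk|ks] := leqP s k.
  have [h _ ->] := left_node _ sk; apply: le_lt_trans h.
  by rewrite mulr_ge0// ltW.
have [|h _ ->] := @right_node s; first by rewrite ks.
by apply: le_lt_trans h; rewrite mulr_ge0// ltW.
Qed.

(** The 3 is forced by [s = k.+2]: there [m s] is 3, while only one full gap is sure to separate [t]
    from [x s]. *)
Let dist_ge s : (s <= n)%N -> s != k -> s != k.+1 -> q * (m s)%:R / 3 <= `|t - x s|.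
Proof.
move=> sn; rewrite ler_pdivrMr// neq_ltn => /orP[sk|ks] sk1.
  have [h _ ->] := left_node _ (ltnW sk).
  have /(ler_wpM2l (ltW q_gt0)) : (m s)%:R <= (k - s)%:R * 3 :> R.
    by rewrite -natrM ler_nat /m; lia.
  by rewrite mulrA; lra.
have [|h _ ->] := @right_node s; first by rewrite ks.
have /(ler_wpM2l (ltW q_gt0)) : (m s)%:R <= (s - k.+1)%:R * 3 :> R.
  by rewrite -natrM ler_nat /m; move/eqP: sk1; lia.
by rewrite mulrA; lra.
Qed.

Let window_m i s : (i <= s <= i + d)%N ->
  (m i <= d.+1 * m s)%N /\ (m s <= d.+1 * m i)%N.
Proof. by rewrite /m; split; nia. Qed.

Let jk : (j <= k < j + d)%N. Proof. by rewrite /j; lia. Qed.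
Let jn : (j + d <= n)%N. Proof. by rewrite /j; lia. Qed.

Let P_gt0 i : (i + d <= n)%N -> 0 < P i.
Proof.
move=> idn; rewrite /P big_seq prodr_gt0// => s; rewrite mem_index_iota => /andP[_ sr].
by apply: dist_gt0; lia.
Qed.

(** A decay of [P j / P i] like [m i] to the power [-(d.+1)], uniform in the position of [t] in its
    cell, even as [t] approaches a node. *)
Let P_ratio i : (i + d <= n)%N ->
  P j * (q * (m i)%:R / (3 * d.+1%:R)) ^+ d.+1 <= P i * (H * d.+1%:R) ^+ d.+1.
Proof.
move=> idn.
(* Replacing the two possibly tiny distances by [H] makes every factor comparable to [m s];
   [window_prod_compare] shows that the replacement can be undone. *)
pose E s := if (s == k) || (s == k.+1) then H else `|t - x s|.
have E_bounds s : (s <= n)%N -> q * (m s)%:R / 3 <= E s <= H * (m s)%:R.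
  move=> sn; rewrite /E; case: eqP => [->|/eqP sk] /=.
    have -> : m k = 1%N by rewrite /m; lia.
    rewrite !mulr1 lexx andbT;  have := qH; have := q_gt0; lra.
  case: eqP => [->|/eqP sk1]; last by rewrite dist_ge// dist_le.
  have -> : m k.+1 = 2%N by rewrite /m; lia.
  by apply/andP; split; have := qH; have := q_gt0; lra.
have eE s : (s <= n)%N -> 0 < `|t - x s| <= E s.
  move=> sn; rewrite dist_gt0//= /E; case: eqP => [->|/eqP sk] /=.
    have [_ _ ->] := left_node _ (leqnn k).
    by have /andP[_ ?] := gap k kn; have /andP[_ ?] := xkt; lra.
  case: eqP => [->|//]; have [|_ _ ->] := @right_node k.+1; first by rewrite leqnn.
  by have /andP[_ ?] := gap k kn; have /andP[? _] := xkt; lra.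
have Ee s : (s <= n)%N -> s != k -> s != k.+1 -> E s = `|t - x s|.
  by move=> _ /negPf sk /negPf sk1; rewrite /E sk sk1.
have const_prod i0 (c : R) : \prod_(i0 <= s < (i0 + d).+1) c = c ^+ d.+1.
  by rewrite prodr_const_nat; congr (_ ^+ _); lia.
apply: le_trans (le_trans _ (window_prod_compare _ _ _ _ _ _ _ _ eE Ee idn jk jn)) _.
  rewrite -(const_prod i) ler_wpM2l ?(ltW (P_gt0 _ jn))// !big_seq.
  apply: ler_prod => s; rewrite mem_index_iota => /andP[is_ sd].
  have /andP[h _] := E_bounds s ltac:(lia).
  rewrite divr_ge0 ?mulr_ge0 ?(ltW q_gt0)//=; apply: le_trans h.
  rewrite invfM mulrA mulrAC ler_wpM2r// ler_pdivrMr// -mulrA ler_wpM2l ?(ltW q_gt0)//.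
  by rewrite -natrM ler_nat mulnC; have [] := @window_m i s ltac:(lia).
rewrite -(const_prod j) ler_wpM2l ?(ltW (P_gt0 _ idn))// !big_seq.
apply: ler_prod => s; rewrite mem_index_iota => /andP[js sd].
have sn : (s <= n)%N by have := jn; lia.
have /andP[_ h] := E_bounds s sn.
apply/andP; split; first by have /andP[/lt_le_trans h1 /h1/ltW] := eE s sn.
apply: le_trans h _; rewrite ler_wpM2l ?(ltW H_gt0)// ler_nat /m.
by have := jk; lia.
Qed.

(** The sign independent of [i] is factored out. The remaining exponent of [(-1) ^+ gamma] is the
    number of grid steps between the window and the cell, hence 0 for a window that contains [x k]
    or [x k.+1]. *)
Let weightE i : (i + d <= n)%N -> fh_weight d gamma x i t =
  (-1) ^+ (gamma * (d + k)) *
  (((-1) ^+ gamma) ^+ ((k - (i + d)) + (i - k.+1)) * (P i ^+ gamma)^-1).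
Proof.
move=> idn; rewrite /fh_weight prodfV prodrXl.
have -> : \prod_(i <= s < (i + d).+1) (t - x s) =
    (-1) ^+ ((i + d - k) + (i - k.+1)) * P i.
  rewrite -prod_signed !big_seq; apply: eq_bigr => s; rewrite mem_index_iota.
  move=> /andP[_ sd]; have [sk|ks] := leqP s k.
    by have [_ _ ->] := left_node _ sk; rewrite mul1r.
  have [|_ _ ->] := @right_node s; first by rewrite ks; lia.
  by rewrite mulN1r opprB.
rewrite exprMn invfM !mulrA; congr (_ * _).
rewrite -!exprM -exprVn invrN invr1 -!exprD -[LHS]signr_odd -[RHS]signr_odd.
congr (_ ^+ nat_of_bool _); rewrite [(_ * gamma)%N]mulnC [(((i + d - k) + _) * gamma)%N]mulnC.
rewrite -!mulnDr !oddM; congr (_ && _); lia.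
Qed.

Let inv_P_le a b : (a + d <= n)%N -> (b + d <= n)%N -> P a <= P b ->
  (P b ^+ gamma)^-1 <= (P a ^+ gamma)^-1.
Proof.
move=> an bn ab; rewrite lef_pV2 ?posrE ?exprn_gt0 ?P_gt0//.
by rewrite lerXn2r ?nnegrE//; apply: ltW; apply: P_gt0.
Qed.

Lemma weight_sum_ge : (P j ^+ gamma)^-1 <=
  `|\sum_(0 <= i < (n - d).+1) fh_weight d gamma x i t|.
Proof.
have z2 : ((-1) ^+ gamma : R) ^+ 2 = 1 by rewrite exprAC sqrrN !expr1n.
rewrite big_seq (eq_bigr (fun i => (-1) ^+ (gamma * (d + k)) *
  (((-1) ^+ gamma) ^+ ((k - (i + d)) + (i - k.+1)) * (P i ^+ gamma)^-1))); last first.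
  by move=> i; rewrite mem_index_iota => idn; apply: weightE; lia.
rewrite -big_seq -mulr_sumr normrMsign; apply: le_trans (ler_norm _).
(* The indices from [j] up to but excluding [B] are those of the windows containing the cell; the
   minimum clips at the last window. *)
pose B := minn k.+1 (n - d).+1.
have Pinv_ge0 i : (i + d <= n)%N -> 0 <= (P i ^+ gamma)^-1.
  by move=> idn; rewrite invr_ge0 exprn_ge0 ?ltW ?P_gt0.
have jB : (j <= B <= (n - d).+1)%N by rewrite /B /j; lia.
have sum_split (F : nat -> R) : \sum_(0 <= i < (n - d).+1) F i =
    \sum_(0 <= i < j) F i + (\sum_(j <= i < B) F i + \sum_(B <= i < (n - d).+1) F i).
  have /andP[h1 h2] := jB.
  by rewrite (big_cat_nat (leq0n j) (leq_trans h1 h2)) (big_cat_nat h1 h2).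
rewrite sum_split.
have left_ge0 : 0 <= \sum_(0 <= i < j) ((-1) ^+ gamma) ^+ ((k - (i + d)) + (i - k.+1)) *
    (P i ^+ gamma)^-1.
  (* Reversal lists the left windows from the cell outwards, so that the exponent becomes the
     summation index; a shift away from [t] enlarges every factor of [P], so the terms decrease. *)
  rewrite big_nat_rev /= add0n big_seq (eq_bigr (fun i => ((-1) ^+ gamma) ^+ i *
    (P (j - i.+1) ^+ gamma)^-1)) => [|i]; last first.
    rewrite mem_index_iota => ij; congr (_ ^+ _ * _).
    by move: ij; rewrite /j; lia.
  rewrite -big_seq; apply: alternating_sum_ge0 => // i ij.
    by apply: Pinv_ge0; have := jn; lia.
  apply: inv_P_le; [have := jn; lia|have := jn; lia|].
  have -> : (j - i.+1 = (j - i.+2).+1)%N by lia.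
  rewrite /P big_add1 /= !big_seq; apply: ler_prod => s; rewrite mem_index_iota => sd.
  rewrite normr_ge0/=.
  have sk : (s.+1 <= k)%N by move: sd ij; rewrite /j; lia.
  have [_ _ ->] := left_node _ sk; have [_ _ ->] := left_node _ (ltnW sk).
  by have /andP[? _] := gap _ (leq_ltn_trans (ltnW sk) kn); have := q_gt0; lra.
have right_ge0 : 0 <= \sum_(B <= i < (n - d).+1)
    ((-1) ^+ gamma) ^+ ((k - (i + d)) + (i - k.+1)) * (P i ^+ gamma)^-1.
  rewrite -[B]add0n big_addn big_seq (eq_bigr (fun i => ((-1) ^+ gamma) ^+ i *
    (P (i + B)%N ^+ gamma)^-1)) => [|i]; last first.
    rewrite mem_index_iota => ij; congr (_ ^+ _ * _).
    by move: ij; rewrite /B; lia.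
  rewrite -big_seq; apply: alternating_sum_ge0 => // i ij.
    by apply: Pinv_ge0; lia.
  apply: inv_P_le; [lia|lia|].
  rewrite /P addSn [leRHS]big_add1 /= !big_seq.
  apply: ler_prod => s; rewrite mem_index_iota => sd.
  rewrite normr_ge0/=.
  have ks : (k < s < n)%N by move: sd ij; rewrite /B; lia.
  have [|_ _ ->] := @right_node s; first by lia.
  have [|_ _ ->] := @right_node s.+1; first by lia.
  by have /andP[_ sn] := ks; have /andP[? _] := gap _ sn; have := q_gt0; lra.
have mid : (P j ^+ gamma)^-1 <= \sum_(j <= i < B)
    ((-1) ^+ gamma) ^+ ((k - (i + d)) + (i - k.+1)) * (P i ^+ gamma)^-1.
  (* In the middle block all exponents vanish; the term of [j] is kept and the other nonnegative
     ones are dropped. *)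
  rewrite big_ltn; last by rewrite /B /j; lia.
  have -> : (k - (j + d) + (j - k.+1) = 0)%N by rewrite /j; lia.
  rewrite expr0 mul1r lerDl big_seq sumr_ge0// => i; rewrite mem_index_iota => ijB.
  have -> : (k - (i + d) + (i - k.+1) = 0)%N by move: ijB; rewrite /B /j; lia.
  by rewrite expr0 mul1r; apply: Pinv_ge0; move: ijB; rewrite /B; lia.
by lra.
Qed.

Let P_ratio_decay (C : R) i : H <= C * q -> (i + d <= n)%N ->
  P j / P i <= (3 * d.+1%:R ^+ 2 * C / (m i)%:R) ^+ d.+1.
Proof.
move=> HC idn; rewrite ler_pdivrMr ?P_gt0//.
have mi0 : 0 < (m i)%:R :> R by [].
have c0 : 0 < q * (m i)%:R / (3 * d.+1%:R) by rewrite divr_gt0 ?mulr_gt0.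
rewrite -(ler_pM2r (exprn_gt0 d.+1 c0)); apply: le_trans (P_ratio _ idn) _.
rewrite mulrAC -exprMn mulrC ler_wpM2r ?(ltW (P_gt0 _ idn))//.
have -> : 3 * d.+1%:R ^+ 2 * C / (m i)%:R * (q * (m i)%:R / (3 * d.+1%:R)) =
    C * q * d.+1%:R.
  by field; rewrite gt_eqF//= pnatr_eq0.
have Cq0 : 0 <= C * q by apply: le_trans HC; exact: ltW.
by rewrite lerXn2r ?nnegrE ?ler_wpM2r// mulr_ge0// ltW.
Qed.

(** The 4 bounds the sum of inverse squares, the power with exponent [d.+1 * gamma] comes from the
    weight ratios, and the next factor from the Lagrange bound. The value [v] stands for [f t]. *)
Lemma cell_error (C eps K v : R) (f : R -> R) (p : nat -> {poly R}) :
  (2 <= gamma)%N -> H <= C * q -> 0 <= eps -> 0 <= K ->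
  (forall i, (i + d <= n)%N -> interpolates f x d i (p i)) ->
  (forall s, (s <= n)%N -> `|f (x s) - v| <= eps + K * `|t - x s|) ->
  `|(\sum_(0 <= i < (n - d).+1) fh_weight d gamma x i t * (p i).[t]) /
    (\sum_(0 <= i < (n - d).+1) fh_weight d gamma x i t) - v| <=
  4 * ((3 * d.+1%:R ^+ 2 * C) ^+ (d.+1 * gamma) * (d.+1%:R * (C * d.+1%:R) ^+ d) *
       (eps + K * (d.+1%:R * H))).
Proof.
move=> gamma2 HC eps0 K0 pP fv.
set w := fun i => fh_weight d gamma x i t.
set W := \sum_(0 <= i < (n - d).+1) fh_weight d gamma x i t.
have Pj := P_gt0 _ jn.
have W_ge : (P j ^+ gamma)^-1 <= `|W| by exact: weight_sum_ge.
have W_gt0 : 0 < `|W| by apply: lt_le_trans W_ge; rewrite invr_gt0 exprn_gt0.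
have C0 : 0 <= C.
  by rewrite -(pmulr_lge0 _ q_gt0); apply: le_trans HC; exact: ltW.
set D := _ * (d.+1%:R * _); set M := eps + _.
have D0 : 0 <= D.
  by rewrite /D mulr_ge0 ?exprn_ge0 ?mulr_ge0 ?exprn_ge0 ?mulr_ge0.
have M0 : 0 <= M by rewrite /M addr_ge0 ?mulr_ge0 ?(ltW H_gt0).
(* The normalized weights sum to 1, so [v] can be moved inside the sum. *)
have -> : (\sum_(0 <= i < (n - d).+1) fh_weight d gamma x i t * (p i).[t]) / W - v =
    (\sum_(0 <= i < (n - d).+1) w i * ((p i).[t] - v)) / W.
  have Wn0 : W != 0 by rewrite -normr_gt0.
  under [in RHS]eq_bigr do rewrite mulrBr.
  by rewrite sumrB -mulr_suml mulrBl; congr (_ - _); rewrite mulrAC divff ?mul1r.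
have m1 i : 1 <= (m i)%:R :> R by rewrite ler1n.
have term i : (i + d <= n)%N ->
    `|w i * ((p i).[t] - v)| <= (D * M * ((m i)%:R ^+ 2)^-1) * `|W|.
  move=> idn; have [sp pE] := pP i idn; have Pi := P_gt0 _ idn.
  have y0 : 0 <= (m i)%:R^-1 :> R by rewrite invr_ge0.
  have wE : `|w i| <= (3 * d.+1%:R ^+ 2 * C) ^+ (d.+1 * gamma) *
      ((m i)%:R^-1) ^+ (2 * d.+1) * `|W|.
    have -> : `|w i| = (P i ^+ gamma)^-1.
      rewrite /w weightE// !normrMsign -exprM normrMsign.
      by rewrite ger0_norm// invr_ge0 exprn_ge0// ltW.
    apply: (@le_trans _ _ ((P j / P i) ^+ gamma * (P j ^+ gamma)^-1)).
      by rewrite exprMn mulrAC divff ?mul1r ?exprVn// expf_neq0// gt_eqF.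
    apply: ler_pM => //; rewrite ?exprn_ge0 ?invr_ge0 ?exprn_ge0 ?divr_ge0 ?(ltW Pi) ?(ltW Pj)//.
    apply: (@le_trans _ _ ((3 * d.+1%:R ^+ 2 * C / (m i)%:R) ^+ (d.+1 * gamma))).
      rewrite exprM lerXn2r ?nnegrE ?P_ratio_decay//.
        by rewrite divr_ge0 ?(ltW Pi) ?(ltW Pj).
      by rewrite exprn_ge0 ?mulr_ge0 ?exprn_ge0.
    rewrite exprMn ler_wpM2l ?exprn_ge0 ?mulr_ge0 ?exprn_ge0//.
    (* Here [gamma >= 2] enters: at least [2 * d.+1] inverse powers of [m i] are available. *)
    by rewrite ler_wiXn2l ?invf_le1// mulnC leq_mul2l gamma2 orbT.
  (* Of the [d.+1] powers of [m i], the Lagrange quotients contribute [d] and the linear growth of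
     the deviation of [f] contributes one. *)
  have pv : `|(p i).[t] - v| <= d.+1%:R * (C * d.+1%:R) ^+ d * (m i)%:R ^+ d.+1 * M.
    have is_n s : (s <= d)%N -> (i + s <= n)%N.
      by move=> sd; rewrite (leq_trans _ idn)// leq_add2l.
    have is_id s : (s <= d)%N -> (i <= i + s <= i + d)%N.
      by move=> sd; rewrite leq_addr leq_add2l.
    have HT s : (s <= d)%N -> `|t - x (i + s)%N| <= H * d.+1%:R * (m i)%:R.
      move=> sd; apply: le_trans (dist_le _ (is_n _ sd)) _.
      rewrite -mulrA ler_wpM2l ?(ltW H_gt0)// -natrM ler_nat.
      by have [] := @window_m i (i + s)%N (is_id _ sd).
    have VM s : (s <= d)%N -> `|(p i).[x (i + s)%N] - v| <= (m i)%:R * M.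
      move=> sd; rewrite pE ?is_id//.
      apply: le_trans (fv _ (is_n _ sd)) _.
      have h1 := m1 i; have h2 : eps <= (m i)%:R * eps by rewrite ler_peMl.
      have := ler_wpM2l K0 (HT s sd); rewrite /M => h3.
      rewrite mulrDr; apply: lerD => //; apply: le_trans h3 _.
      by rewrite [leRHS](_ : _ = K * (H * d.+1%:R * (m i)%:R)); [|ring].
    have := @polynomial_deviation R d (fun s => x (i + s)%N) (p i) t v q _ _ sp q_gt0 _ HT VM.
    move=> /(_ _)/le_trans; apply.
      move=> s sd; rewrite addnS.
      have sn : (i + s < n)%N by apply: leq_trans idn; rewrite ltn_add2l.
      by have /andP[] := gap _ sn.
    have -> : d.+1%:R * (C * d.+1%:R) ^+ d * (m i)%:R ^+ d.+1 * M =
        d.+1%:R * (C * d.+1%:R * (m i)%:R) ^+ d * ((m i)%:R * M).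
      by rewrite [in RHS]exprMn exprS; ring.
    rewrite ler_wpM2r ?mulr_ge0// ler_wpM2l//.
    rewrite lerXn2r ?nnegrE ?divr_ge0 ?mulr_ge0 ?(ltW H_gt0) ?(ltW q_gt0)//.
    rewrite ler_pdivrMr// [leRHS](_ : _ = C * q * d.+1%:R * (m i)%:R); last by ring.
    by rewrite !ler_wpM2r.
  rewrite normrM; apply: le_trans (ler_pM _ _ wE pv) _ => //.
  set A := (3 * _ * C) ^+ _ in D D0 *; set B := d.+1%:R * _ in D D0 *.
  (* Half of the inverse powers cancel the growth of [p i]; the [d.+1] left are at least 2 since [d]
     is positive, which is enough for summability. *)
  have -> : A * (m i)%:R^-1 ^+ (2 * d.+1) * `|W| * (B * (m i)%:R ^+ d.+1 * M) =
      D * M * (m i)%:R^-1 ^+ d.+1 * `|W|.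
    rewrite /D mulSn mul1n exprD exprVn.
    field; by rewrite expf_neq0// pnatr_eq0.
  rewrite ler_wpM2r// (ler_wpM2l (mulr_ge0 D0 M0))// -exprVn.
  by rewrite ler_wiXn2l ?invf_le1.
rewrite normrM normfV ler_pdivrMr//; apply: le_trans (ler_norm_sum _ _ _) _.
apply: (@le_trans _ _ (\sum_(0 <= i < (n - d).+1) D * M * `|W| * ((m i)%:R ^+ 2)^-1)).
  rewrite !big_seq; apply: ler_sum => i; rewrite mem_index_iota ltnS leq_subRL// addnC.
  by move=> idn; rewrite [leRHS]mulrAC; exact: term.
have -> : 4 * (D * M) * `|W| = D * M * `|W| * 4 by ring.
rewrite -mulr_sumr (ler_wpM2l (mulr_ge0 (mulr_ge0 D0 M0) (normr_ge0 W)))//.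
exact: sum_inv_sqr_dist.
Qed.

End Cell.

(** * Passage to the limit over the grids *)

Lemma gaps_between (R : realType) (a b : R) (n : nat) (x : nat -> R) :
  (0 < n)%N -> is_nodes a b n x ->
  0 < min_gap n x /\
  forall s, (s < n)%N -> min_gap n x <= x s.+1 - x s <= max_gap n x.
Proof.
move=> n0 [_ _ xS].
have gap0 s : (s < n)%N -> 0 < x s.+1 - x s by move=> sn; rewrite subr_gt0 xS.
split.
  (* The initial value [x n - x 0] of the minimum must be positive too; it is the sum of the
     gaps. *)
  apply: lt_bigmin => [|s _]; last exact: gap0.
  rewrite -(telescope_sumr x (leq0n n)) big_ltn// ltr_wpDr ?gap0//.
  by rewrite big_seq sumr_ge0// => s; rewrite mem_index_iota => /andP[_ /gap0/ltW].
move=> s sn; apply/andP; split.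
  exact: (bigmin_le _ (Ordinal sn) (fun s : 'I_n => x s.+1 - x s)).
exact: (le_bigmax _ (fun s : 'I_n => x s.+1 - x s) (Ordinal sn)).
Qed.

Lemma nodes_cell (R : realType) (x : nat -> R) (t : R) (n : nat) :
  (forall s, (s <= n)%N -> t != x s) -> x 0%N <= t <= x n ->
  exists2 k, (k < n)%N & x k < t < x k.+1.
Proof.
elim: n => [|n IH] tx /andP[t0 tn].
  by have /eqP := tx 0%N isT; case; apply/eqP; rewrite eq_le t0 tn.
have [tn'|nt] := leP t (x n).
  have [|//|k kn tk] := IH; first by move=> s /leqW/tx.
    by rewrite t0.
  by exists k => //; exact: ltnW.
exists n => //; rewrite nt lt_neqAle tn andbT; exact: tx.
Qed.

Lemma interp_poly_nodes (R : realType) (a b : R) (d i n : nat) (x : nat -> R)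
    (f : R -> R) :
  is_nodes a b n x -> (i + d <= n)%N -> interpolates f x d i (interp_poly f x d i).
Proof.
move=> [_ _ xS] idn; apply: interp_polyP => s r; rewrite !inE => si ri xsr.
have lt_x l u : (l < u <= n)%N -> x l < x u.
  elim: u => // u IHu; rewrite ltnS => /andP[lu un].
  have := xS u un; move: lu; rewrite leq_eqVlt => /orP[/eqP ->//|lu].
  by apply: lt_trans; apply: IHu; rewrite lu ltnW.
apply/eqP/negPn/negP; rewrite neq_ltn => /orP[sr|rs].
  by have := @lt_x s r ltac:(lia); rewrite xsr ltxx.
by have := @lt_x r s ltac:(lia); rewrite xsr ltxx.
Qed.

Lemma cvg_sup_norm0 (R : realType) (a b : R) (g : nat -> R -> R) : a <= b ->
  (forall e : R, 0 < e -> \forall n \near \oo,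
     {in `[a, b], forall t, `|g n t| <= e}) ->
  (fun n => sup_norm a b (g n)) @ \oo --> 0%:E.
Proof.
move=> ab gP.
(* This needs a nonempty segment, as an empty supremum would be minus infinity. *)
have sup_ge0 n : (0%:E <= sup_norm a b (g n))%E.
  apply: (@le_trans _ _ `|g n a|%:E); first by rewrite lee_fin.
  by apply: ereal_sup_ubound; exists a => //=; rewrite in_itv/= lexx.
have sup_le e : 0 < e -> \forall n \near \oo, (sup_norm a b (g n) <= e%:E)%E.
  move=> /gP; apply: filterS => n gn.
  by apply: ge_ereal_sup => _ [t tab <-]; rewrite lee_fin; exact: gn.
apply/fine_cvgP; split.
  apply: filterS (sup_le 1 ltr01) => n sn.
  by rewrite fin_real// (lt_le_trans _ (sup_ge0 n)) ?(le_lt_trans sn) ?ltry ?ltNyr.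
apply/cvgrPdist_le => e /sup_le; apply: filterS => n /= sn.
rewrite sub0r normrN ger0_norm ?fine_ge0//.
by rewrite -lee_fin fineK// fin_real// (lt_le_trans _ (sup_ge0 n)) ?(le_lt_trans sn) ?ltry ?ltNyr.
Qed.

Theorem theorem5p1 (R : realType) (a b : R) (d gamma : nat)
    (hd : (1 <= d)%N) (hgamma : (2 <= gamma)%N)
    (x : nat -> nat -> R)
    (hx : forall n : nat, (d <= n)%N -> is_nodes a b n (x n))
    (hmaxmin : same_order (fun n : nat => max_gap n (x n))
                          (fun n : nat => min_gap n (x n)))
    (hmin : same_order (fun n : nat => min_gap n (x n))
                       (fun n : nat => n%:R^-1))
    (f : R -> R) (hf : {within `[a, b], continuous f}) :
  (fun n : nat =>
     sup_norm a b (fun t : R => fh_interpolant d gamma n (x n) f t - f t))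
    @ \oo --> 0%:E.
Proof.
have ordered n : (d <= n)%N ->
    forall s r, (s <= r <= n)%N -> x n s <= x n r.
  move=> dn s r /andP[sr rn].
  have [min0 gap] := gaps_between _ _ _ _ _ (leq_trans hd dn) (hx n dn).
  have := @increments_sum _ _ _ _ _ gap s r; rewrite sr rn => /(_ isT)/andP[h _].
  by rewrite -subr_ge0; apply: le_trans h; rewrite mulr_ge0// ltW.
have ab : a <= b.
  by have [<- <- _] := hx d (leqnn d); apply: ordered; rewrite ?leqnn.
have [c [C [_ C0 HC]]] := hmaxmin; have [c' [C' [_ C'0 HC']]] := hmin.
apply: cvg_sup_norm0 => // e e0.
pose D : R := (3 * d.+1%:R ^+ 2 * C) ^+ (d.+1 * gamma) * (d.+1%:R * (C * d.+1%:R) ^+ d).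
have D0 : 0 < D by rewrite !(mulr_gt0, exprn_gt0).
(* Chosen so that the [eps] part of the bound in [cell_error] is exactly [e / 2]; [K] is then fixed
   before [n]. *)
have eps0 : 0 < e / (8 * D) by apply: divr_gt0 => //; exact: mulr_gt0.
have [K K0 fK] := within_continuous_modulus _ _ _ _ hf _ eps0.
near=> n.
have dn : (d <= n)%N by near: n; exact: nbhs_infty_ge.
have n0 : (0 < n)%N by exact: leq_trans dn.
have nR0 : 0 < n%:R :> R by rewrite ltr0n.
have [min0 gap] := gaps_between _ _ _ _ _ n0 (hx n dn).
have maxC : max_gap n (x n) <= C * min_gap n (x n).
  by rewrite -ler_pdivrMr//; near: n; apply: filterS HC => n /andP[].
have minC' : min_gap n (x n) * n%:R <= C'.
  have : min_gap n (x n) / n%:R^-1 <= C' by near: n; apply: filterS HC' => n /andP[].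
  by rewrite invrK.
(* Since [max_gap] is at most [C * C' / n], this threshold brings the part of the bound containing
   [K] below [e / 2]. *)
have nK : 8 * D * K * d.+1%:R * C * C' / e < n%:R.
  by near: n; exact: nbhs_infty_gtr.
move=> t tab; rewrite /fh_interpolant; case: ifPn => [_|/existsPn tx].
  by rewrite subrr normr0 ltW.
have [xa xb _] := hx n dn.
have tnode s : (s <= n)%N -> t != x n s.
  by move=> sn; have := tx (Ordinal (sn : (s < n.+1)%N)).
have tx0n : x n 0%N <= t <= x n n by rewrite xa xb; move: tab; rewrite in_itv.
have [k kn tk] := nodes_cell _ _ _ _ tnode tx0n.
have fv s : (s <= n)%N -> `|f (x n s) - f t| <= e / (8 * D) + K * `|t - x n s|.
  move=> sn; rewrite [`|t - _|]distrC; apply: fK => //.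
  by rewrite in_itv/= -{1}xa -xb !ordered ?sn ?leqnn.
have pP i := interp_poly_nodes _ _ _ d i _ _ f (hx n dn).
have := @cell_error _ n d gamma k (x n) t _ _ min0 gap kn tk hd dn C _ K (f t) f
  (interp_poly f (x n) d) hgamma maxC (ltW eps0) K0 pP fv.
move=> /le_trans; apply.
rewrite -/D mulrDr mulrDr.
have -> : 4 * (D * (e / (8 * D))) = e / 2 by field; rewrite gt_eqF.
have : 4 * (D * (K * (d.+1%:R * max_gap n (x n)))) <= e / 2.
  have h : max_gap n (x n) * n%:R <= C * C'.
    apply: le_trans (ler_wpM2r (ltW nR0) maxC) _.
    by rewrite -mulrA ler_wpM2l// ltW.
  rewrite -(ler_pM2r nR0).
  have DK0 := mulr_ge0 (ltW D0) K0.
  have c0 : 0 <= 4 * (D * K) * d.+1%:R by apply: mulr_ge0 => //; exact: mulr_ge0.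
  move: nK; rewrite ltr_pdivrMr// => nK.
  by have := ler_wpM2l c0 h; lra.
by lra.
Unshelve. all: by end_near. Qed.
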